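(* Let $\mathcal{L}$ be a first-order signature, let $(\mathfrak{M}_i : i\in I)$ be a family of AML $\mathcal{L}$-structures, let $\mathcal{U}$ be an ultrafilter on $I$, and let $\mathfrak{M}=\prod_{\mathcal{U}}\mathfrak{M}_i$ be their AML ultraproduct. Let $\varphi(x_1,\ldots,x_n)$ be an AML $\mathcal{L}$-formula and let $a^1=[(a^1_i)]_{\mathcal{U}},\ldots,a^n=[(a^n_i)]_{\mathcal{U}}\in M$. Then $\mathfrak{M}\models\varphi(a^1,\ldots,a^n)$ if and only if $\{i\in I : \mathfrak{M}_i\models\varphi(a^1_i,\ldots,a^n_i)\}\in\mathcal{U}$.
   Context: AML formulas: given a first-order signature $\mathcal{L}$, AML $\mathcal{L}$-formulas are built from first-order atomic $\mathcal{L}$-formulas using $\neg$, $\wedge$, $\exists x$, $\forall x$, and the measure constructor: if $\vec x=(x_1,\ldots,x_n)$ is a tuple of distinct variables, $q$ is a non-negative rational, $\bowtie\in\{<,\leq\}$ and $\varphi$ is a formula, then $m_{\vec x}\bowtie q.\varphi$ is a formula in which $x_1,\ldots,x_n$ become bound. ($m_{\vec x}\geq q.\varphi$ abbreviates $\neg m_{\vec x}<q.\varphi$ and $m_{\vec x}>q.\varphi$ abbreviates $\neg m_{\vec x}\leq q.\varphi$.) AML quasistructures and structures: an AML $\mathcal{L}$-quasistructure $\mathfrak{M}$ consists of a first-order $\mathcal{L}$-structure with universe $M$; for each $n\geq 1$ an algebra $\mathcal{B}_n$ of subsets of $M^n$ and a finitely additive measure $\mu_n:\mathcal{B}_n\to[0,\infty]$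 such that $\mathcal{B}_{m+n}$ extends the product algebra $\mathcal{B}_m\otimes\mathcal{B}_n$ and $\mu_{m+n}$ extends $\mu_m\times\mu_n$; and maps $v_n:\mathcal{B}_n\to\{\oplus,\ominus,\odot\}$ with $v_n(X)=\odot$ whenever $\mu_n(X)\notin\mathbb{Q}$. Satisfaction is defined by recursion on formulas (on the nesting depth of measure constructors), with the usual clauses for atomic formulas, connectives and quantifiers, and for the measure constructor as follows: writing $\varphi(M,\vec b)=\{\vec a\in M^{|\vec x|}:\mathfrak{M}\models\varphi(\vec a,\vec b)\}$ and assuming it lies in $\mathcal{B}_{|\vec x|}$, $\mathfrak{M}\models m_{\vec x}<r.\varphi(\vec x,\vec b)$ iff $\mu(\varphi(M,\vec b))<r$, or $\mu(\varphi(M,\vec b))=r$ and $v(\varphi(M,\vec b))=\ominus$; and $\mathfrak{M}\models m_{\vec x}\leq r.\varphi(\vec x,\vec b)$ iff $\mu(\varphi(M,\vec b))<r$, or $\mu(\varphi(M,\vec b))=r$ and $v(\varphi(M,\vec b))\neq\oplus$. An AML $\mathcal{L}$-structure is a quasistructure in which every set $\varphi(M,\vec b)$ defined by an AML formula with parameters belongs to the corresponding $\mathcal{B}_n$ (so satisfaction is defined for all formulas). AML ultraproduct: for AML structures $(\mathfrak{M}_i:i\in I)$ and an ultrafilter $\mathcal{U}$ on $I$, $\prod_{\mathcal{U}}\mathfrak{M}_i$ has as first-order part the classical ultraproduct; $\mathcal{B}_n$ consists of the sets $\prod_{\mathcal{U}}A_i=\{[(a_i)]_{\mathcal{U}}:\{i:a_i\in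 A_i\}\in\mathcal{U}\}$ with $A_i\in\mathcal{B}^{\mathfrak{M}_i}_n$; $\mu_n(\prod_{\mathcal{U}}A_i)=\lim_{\mathcal{U}}\mu^{\mathfrak{M}_i}_n(A_i)$ (ultralimit in $[0,\infty]$); and if this value $r$ is rational, $v_n(\prod_{\mathcal U}A_i)$ is $\oplus$ if $\mu^{\mathfrak{M}_i}_n(A_i)>r$ for $\mathcal{U}$-almost all $i$, $\ominus$ if $\mu^{\mathfrak{M}_i}_n(A_i)<r$ for $\mathcal{U}$-almost all $i$, and otherwise (when $\mu^{\mathfrak{M}_i}_n(A_i)=r$ for almost all $i$) the value that $v^{\mathfrak{M}_i}_n(A_i)$ takes for $\mathcal{U}$-almost all $i$; if $r$ is irrational, $v_n=\odot$. *)

(* Defs.v *)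
From HB Require Import structures.
From mathcomp Require Import all_boot all_order all_algebra.
From mathcomp Require Import all_classical all_reals all_analysis.

Set Implicit Arguments.
Unset Strict Implicit.
Unset Printing Implicit Defensive.

Import Order.TTheory GRing.Theory Num.Theory.

Local Open Scope classical_set_scope.
Local Open Scope ring_scope.
Local Open Scope ereal_scope.
Local Open Scope quotient_scope.

(** * Syntax *)

(* Constants are function symbols of arity 0. *)
Record signature := Signature {
  fun_sym : Type;
  fun_arity : fun_sym -> nat;
  rel_sym : Type;
  rel_arity : rel_sym -> nat }.

(* Variables are named by natural numbers. *)
Inductive term (L : signature) :=
| Var of nat
| App (f : fun_sym L) of ('I_(fun_arity f) -> term L).

Inductive comparison := CLt | CLe.

Inductive formula (L : signature) :=
| FEq of term L & term L
| FRel (r : rel_sym L) of ('I_(rel_arity r) -> term L)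
| FNot of formula L
| FAnd of formula L & formula L
| FEx of nat & formula L
| FAll of nat & formula L
| FMeas (c : comparison) (n : nat) (x : n.-tuple nat) (q : rat) of
    (0 < n)%N & uniq x & (0 <= q)%R & formula L.

Fixpoint term_vars (L : signature) (t : term L) : set nat :=
  match t with
  | Var x => [set x]
  | App f ts => [set y | exists k, term_vars (ts k) y]
  end.

Fixpoint free_vars (L : signature) (phi : formula L) : set nat :=
  match phi with
  | FEq t u => term_vars t `|` term_vars u
  | FRel r ts => [set y | exists k, term_vars (ts k) y]
  | FNot psi => free_vars psi
  | FAnd psi chi => free_vars psi `|` free_vars chi
  | FEx x psi | FAll x psi => free_vars psi `\ x
  | FMeas _ _ x _ _ _ _ psi => free_vars psi `\` [set` x]
  end.

(** * Structures *)

Record fo_structure (L : signature) := FOStructure {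
  carrier :> Type;
  carrier_inhabited : inhabited carrier;
  fun_interp : forall f : fun_sym L, ('I_(fun_arity f) -> carrier) -> carrier;
  rel_interp : forall r : rel_sym L, set ('I_(rel_arity r) -> carrier) }.

(* [Oplus], [Ominus], [Odot] are the three values of the maps v_n. *)
Inductive sgn := Oplus | Ominus | Odot.

(* The raw data (B_n, mu_n, v_n) over a first-order structure, M^n being
   ['I_n -> M].  Only the indices n > 0 are meaningful, and [mu n] and [v n] are
   meaningful only on members of [alg n]; outside, their values are arbitrary
   and are never constrained. *)
Record aml_data (L : signature) (R : realType) := AMLData {
  fo_part :> fo_structure L;
  alg : forall n, set (set ('I_n -> fo_part));
  mu : forall n, set ('I_n -> fo_part) -> \bar R;
  v : forall n, set ('I_n -> fo_part) -> sgn }.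
Arguments alg {L R} _ _ _.
Arguments mu {L R} _ {n} _.
Arguments v {L R} _ {n} _.

Definition set_algebra (T : Type) (B : set (set T)) : Prop :=
  [/\ B setT, setC_closed B & setU_closed B].

(* The product A x B, under the identification M^m x M^n = M^(m+n). *)
Definition rectangle (T : Type) (m n : nat) (A : set ('I_m -> T))
    (B : set ('I_n -> T)) : set ('I_(m + n) -> T) :=
  [set w | A (fun i => w (lshift n i)) /\ B (fun j => w (rshift m j))].

(* The product algebra: the algebra generated by the rectangles. *)
Definition product_algebra (T : Type) (m n : nat) (Bm : set (set ('I_m -> T)))
    (Bn : set (set ('I_n -> T))) : set (set ('I_(m + n) -> T)) :=
  smallest (@set_algebra _) [set rectangle A B | A in Bm & B in Bn].

Definition is_rational (R : realType) (r : \bar R) : Prop :=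
  exists q : rat, r = (ratr q)%:E.

(* A finitely additive measure on the product algebra is determined by its
   values on rectangles, so [qs_mu_product] says that mu_(m+n) extends the
   product mu_m x mu_n.  Multiplication on [0, +oo] has 0 * +oo = 0. *)
Record is_quasistructure (L : signature) (R : realType) (M : aml_data L R) :
    Prop := IsQuasistructure {
  qs_algebra : forall n, (0 < n)%N -> set_algebra (alg M n);
  qs_mu_ge0 : forall n (A : set ('I_n -> M)), (0 < n)%N ->
    alg M n A -> 0 <= mu M A;
  qs_mu_set0 : forall n, (0 < n)%N -> mu M (set0 : set ('I_n -> M)) = 0;
  qs_mu_additive : forall n (A B : set ('I_n -> M)), (0 < n)%N ->
    alg M n A -> alg M n B -> A `&` B = set0 ->
    mu M (A `|` B) = mu M A + mu M B;
  qs_alg_product : forall m n, (0 < m)%N -> (0 < n)%N ->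
    product_algebra (alg M m) (alg M n) `<=` alg M (m + n);
  qs_mu_product : forall m n (A : set ('I_m -> M)) (B : set ('I_n -> M)),
    (0 < m)%N -> (0 < n)%N -> alg M m A -> alg M n B ->
    mu M (rectangle A B) = mu M A * mu M B;
  qs_v : forall n (A : set ('I_n -> M)), (0 < n)%N -> alg M n A ->
    ~ is_rational (mu M A) -> v M A = Odot }.

(** * Satisfaction *)

Definition assign1 (T : Type) (e : nat -> T) (x : nat) (b : T) : nat -> T :=
  fun y => if y == x then b else e y.

Definition assign (T : Type) (e : nat -> T) (n : nat) (x : n.-tuple nat)
    (a : 'I_n -> T) : nat -> T :=
  fun y => if [pick k | tnth x k == y] is Some k then a k else e y.

Fixpoint eval (L : signature) (M : fo_structure L) (e : nat -> M) (t : term L) :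
    M :=
  match t with
  | Var x => e x
  | App f ts => fun_interp (fun k => eval e (ts k))
  end.

Definition meas_holds (L : signature) (R : realType) (M : aml_data L R)
    (c : comparison) (n : nat) (q : rat) (X : set ('I_n -> M)) : Prop :=
  mu M X < (ratr q)%:E \/
  mu M X = (ratr q)%:E /\
    match c with CLt => v M X = Ominus | CLe => v M X <> Oplus end.

(* Satisfaction is meant to be defined at a measure constructor only when the
   set it measures lies in [alg M n].  [sat] is total, and is the intended
   relation on data satisfying [definable_in_alg], where every set measured in
   the recursion does lie in the algebra. *)
Fixpoint sat (L : signature) (R : realType) (M : aml_data L R) (e : nat -> M)
    (phi : formula L) : Prop :=
  match phi with
  | FEq t u => eval e t = eval e u
  | FRel r ts => rel_interp (fun k => eval e (ts k))
  | FNot psi => ~ sat e psi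
  | FAnd psi chi => sat e psi /\ sat e chi
  | FEx x psi => exists b, sat (assign1 e x b) psi
  | FAll x psi => forall b, sat (assign1 e x b) psi
  | FMeas c n x q _ _ _ psi =>
      meas_holds c q [set a : 'I_n -> M | sat (assign e x a) psi]
  end.

(* The set phi(M, b); the assignment [e] carries the parameters b. *)
Definition definable (L : signature) (R : realType) (M : aml_data L R)
    (phi : formula L) (n : nat) (x : n.-tuple nat) (e : nat -> M) :
    set ('I_n -> M) :=
  [set a | sat (assign e x a) phi].

Definition definable_in_alg (L : signature) (R : realType)
    (M : aml_data L R) : Prop :=
  forall (phi : formula L) (n : nat) (x : n.-tuple nat) (e : nat -> M),
    (0 < n)%N -> uniq x -> alg M n (definable phi x e).

Record is_aml_structure (L : signature) (R : realType) (M : aml_data L R) :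
    Prop := IsAMLStructure {
  aml_quasi : is_quasistructure M;
  aml_definable : definable_in_alg M }.

(* M |= phi(a_1, ..., a_n), for a formula phi(x_1, ..., x_n) whose free
   variables are among x_1, ..., x_n. *)
Definition models (L : signature) (R : realType) (M : aml_data L R)
    (phi : formula L) (n : nat) (x : n.-tuple nat) (a : 'I_n -> M) : Prop :=
  forall e : nat -> M, (forall k, e (tnth x k) = a k) -> sat e phi.
Arguments models {L R} M phi {n} x a.

(** * Ultraproducts *)

Section Ultraproduct.
Variables (L : signature) (R : realType) (I : Type) (U : set_system I).
Context {UU : UltraFilter U}.
Variable M : I -> aml_data L R.

Local Notation dprod := {classic forall i, M i}.

Definition uequiv (a b : dprod) : bool := `[< \forall i \near U, a i = b i >].

Lemma uequiv_equiv : equiv_class_of uequiv.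
Proof.
split=> [a|a b|b a c].
- by apply/asboolP; near=> i.
- by apply/asboolP/asboolP => ab; near do apply/esym; exact: ab.
- move=> /asboolP ab /asboolP bc; apply/asboolP.
  by apply: filterS2 ab bc => i -> ->.
Unshelve. all: by end_near. Qed.

Canonical uequiv_equivRel := EquivRelPack uequiv_equiv.

Definition ucarrier : Type := {eq_quot uequiv}.

(* [uclass a] is the class of the family (a_i). *)
Definition uclass (a : forall i, M i) : ucarrier := \pi_({eq_quot uequiv}) (a : dprod).

Definition urepr (x : ucarrier) : forall i, M i := repr (x : {eq_quot uequiv}).

Definition utuple (n : nat) (a : forall i, 'I_n -> M i) : 'I_n -> ucarrier :=
  fun k => uclass (fun i => a i k).

Definition uset (n : nat) (A : forall i, set ('I_n -> M i)) :
    set ('I_n -> ucarrier) :=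
  [set utuple a | a in [set a | \forall i \near U, A i (a i)]].

Lemma ucarrier_inhabited : inhabited ucarrier.
Proof.
have p i : exists b : M i, True.
  by have [b] := carrier_inhabited (M i); exists b.
exact: (inhabits (uclass (fun i => sval (cid (p i))))).
Qed.

Definition ufo : fo_structure L := {|
  carrier := ucarrier;
  carrier_inhabited := ucarrier_inhabited;
  fun_interp := fun f x =>
    uclass (fun i => fun_interp (fun k => urepr (x k) i));
  rel_interp := fun r => uset (fun i => @rel_interp L (M i) r) |}.

Definition ualg (n : nat) : set (set ('I_n -> ucarrier)) :=
  [set uset A | A in [set A | forall i, alg (M i) n (A i)]].

(* The ultralimit of mu_n(A_i), in the compact Hausdorff space [-oo, +oo]. *)
Definition umu_family (n : nat) (A : forall i, set ('I_n -> M i)) : \bar R :=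
  lim (mu (M i) (A i) @[i --> U]).

Definition uv_family (n : nat) (A : forall i, set ('I_n -> M i)) : sgn :=
  let r := umu_family A in
  if `[< ~ is_rational r >] then Odot
  else if `[< \forall i \near U, r < mu (M i) (A i) >] then Oplus
  else if `[< \forall i \near U, mu (M i) (A i) < r >] then Ominus
  else if `[< \forall i \near U, v (M i) (A i) = Oplus >] then Oplus
  else if `[< \forall i \near U, v (M i) (A i) = Ominus >] then Ominus
  else Odot.

(* Some family (A_i) of members of the algebras such that X is the ultraproduct
   of the A_i; by [umuE] and [uvE] below, the choice is immaterial. *)
Definition ufamily (n : nat) (X : set ('I_n -> ucarrier)) :
    forall i, set ('I_n -> M i) :=
  xget (fun=> set0) [set A : {classic forall i, set ('I_n -> M i)} |
    (forall i, alg (M i) n (A i)) /\ uset A = X].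
Arguments ufamily {n} X i : simpl never.

Definition ultraproduct : aml_data L R := {|
  fo_part := ufo;
  alg := ualg;
  mu := fun n X => umu_family (ufamily X);
  v := fun n X => uv_family (ufamily X) |}.

Lemma uclass_eq (a b : forall i, M i) :
  uclass a = uclass b <-> \forall i \near U, a i = b i.
Proof.
split; first by move=> /eqquotP /asboolP.
by move=> ab; apply/eqquotP/asboolP.
Qed.

Lemma utuple_eq n (a b : forall i, 'I_n -> M i) :
  utuple a = utuple b <-> \forall i \near U, a i = b i.
Proof.
split=> [ab|ab].
  have H (k : 'I_n) : \forall i \near U, a i k = b i k.
    by apply/uclass_eq; exact: (congr1 (@^~ k) ab).
  have : \forall i \near U, forall k : 'I_n, a i k = b i k.
    exact: (@filter_forall _ _ (fun k i => a i k = b i k)).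
  by apply: filterS => i abi; apply/funext.
by apply/funext => k; apply/uclass_eq; apply: filterS ab => i ->.
Qed.

Lemma uset_utuple n (A : forall i, set ('I_n -> M i)) (a : forall i, 'I_n -> M i) :
  uset A (utuple a) <-> \forall i \near U, A i (a i).
Proof.
split=> [[b /= Ab /utuple_eq ba]|Aa]; last by exists a.
by apply: filterS2 Ab ba => i Abi <-.
Qed.

Lemma uset_sub n (A B : forall i, set ('I_n -> M i)) :
  uset A `<=` uset B -> \forall i \near U, A i `<=` B i.
Proof.
move=> AB; apply: contrapT => nAB.
have {}nAB : \forall i \near U, exists a, A i a /\ ~ B i a.
  have [//|] := in_ultra_setVsetC [set i | A i `<=` B i] UU.
  by apply: filterS => i /= /existsNP[a /not_implyP]; exists a.
have p i : exists a, (exists b, A i b /\ ~ B i b) -> A i a /\ ~ B i a.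
  have [[b ?]|nb] := pselect (exists b, A i b /\ ~ B i b).
    by exists b.
  by have [b] := carrier_inhabited (M i); exists (fun=> b).
pose a i := sval (cid (p i)); have aP i := svalP (cid (p i)).
have /AB/uset_utuple Ba : uset A (utuple a).
  by apply/uset_utuple; apply: filterS nAB => i /aP[].
apply: (@filter_not_empty _ U).
by apply: filterS2 nAB Ba => i /aP[_].
Qed.

Lemma uset_inj n (A B : forall i, set ('I_n -> M i)) :
  uset A = uset B -> \forall i \near U, A i = B i.
Proof.
move=> AB; have /uset_sub H1 : uset A `<=` uset B by rewrite AB.
have /uset_sub H2 : uset B `<=` uset A by rewrite AB.
by apply: filterS2 H1 H2 => i ? ?; apply/seteqP.
Qed.

Lemma ufamily_near n (A : forall i, set ('I_n -> M i)) :
  (forall i, alg (M i) n (A i)) -> \forall i \near U, ufamily (uset A) i = A i.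
Proof.
move=> HA; apply: uset_inj; rewrite /ufamily.
by case: xgetP => [B _ [] //|/(_ A)[]].
Qed.

Lemma umu_family_near n (A B : forall i, set ('I_n -> M i)) :
  (\forall i \near U, A i = B i) -> umu_family A = umu_family B.
Proof.
move=> AB; congr lim; apply/seteqP; split=> S /= HS.
  by apply: filterS2 AB HS => i /= <-.
by apply: filterS2 AB HS => i /= ->.
Qed.

Lemma uv_family_near n (A B : forall i, set ('I_n -> M i)) :
  (\forall i \near U, A i = B i) -> uv_family A = uv_family B.
Proof.
move=> AB; rewrite /uv_family (umu_family_near AB).
have E (P : forall i, set ('I_n -> M i) -> Prop) :
    `[< \forall i \near U, P i (A i) >] = `[< \forall i \near U, P i (B i) >].
  by apply: asbool_equiv_eq; split=> H; apply: filterS2 AB H => i ->.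
by rewrite (E (fun i X => _ < mu (M i) X)) (E (fun i X => mu (M i) X < _))
  (E (fun i X => v (M i) X = Oplus)) (E (fun i X => v (M i) X = Ominus)).
Qed.

Lemma umuE n (A : forall i, set ('I_n -> M i)) :
  (forall i, alg (M i) n (A i)) -> mu ultraproduct (uset A) = umu_family A.
Proof. by move=> /ufamily_near/umu_family_near. Qed.

Lemma uvE n (A : forall i, set ('I_n -> M i)) :
  (forall i, alg (M i) n (A i)) -> v ultraproduct (uset A) = uv_family A.
Proof. by move=> /ufamily_near/uv_family_near. Qed.

End Ultraproduct.

Arguments uclass {L R I} U {UU} {M} a.
Arguments uset {L R I} U {UU} {M n} A _.
Arguments umu_family {L R I} U {M n} A.
Arguments uv_family {L R I} U {M n} A.
Arguments ultraproduct {L R I} U {UU} M.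

(* Main.v *)
(* Los's theorem by induction on formulas.  At a measure constructor the
   induction hypothesis says that the set defined in the ultraproduct is the
   ultraproduct of the sets A_i defined in the factors.  The measures mu(A_i)
   converge along the ultrafilter to some r in the compact space [-oo, +oo].  If
   r <> q, then mu(A_i) lies on the same side of q as r for almost all i; if
   r = q, the sign v of the ultraproduct records on which side of q almost all
   mu(A_i) lie, or, when they equal q, the common value of the v(A_i). *)

Require Import Defs.
From HB Require Import structures.
From mathcomp Require Import all_boot all_order all_algebra.
From mathcomp Require Import all_classical all_reals all_analysis.

Local Open Scope classical_set_scope.

Set Implicit Arguments.
Unset Strict Implicit.
Unset Printing Implicit Defensive.

Import Order.TTheory GRing.Theory Num.Theory.

(** * Ultrafilters and ultralimits of extended reals *)

Lemma ultra_near_or (I : Type) (U : set_system I) (UU : UltraFilter U)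
    (P Q : I -> Prop) :
  (\forall i \near U, P i \/ Q i) ->
  (\forall i \near U, P i) \/ (\forall i \near U, Q i).
Proof.
move=> PQ; have [|nP] := in_ultra_setVsetC [set i | P i] UU; first by left.
by right; apply: filterS2 PQ nP => i [].
Qed.

Lemma ultra_near_not (I : Type) (U : set_system I) (UU : UltraFilter U)
    (P : I -> Prop) :
  ~ (\forall i \near U, P i) <-> \forall i \near U, ~ P i.
Proof.
split=> [nP|nP P_]; first by have [] := in_ultra_setVsetC [set i | P i] UU.
by apply: (@filter_not_empty _ U); apply: filterS2 nP P_ => i.
Qed.

(** Any a below the supremum is exceeded by some almost-everywhere lower bound. Any b above it is
    not such a bound, so by maximality of the ultrafilter [f i < b] for almost all i. *)
Lemma ultra_cvg_ereal (R : realType) (I : Type) (U : set_system I)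
    (UU : UltraFilter U) (f : I -> \bar R) :
  f i @[i --> U] --> ereal_sup [set x | \forall i \near U, (x <= f i)%E].
Proof.
set s := ereal_sup _.
have lts (a : \bar R) : (a < s)%E -> \forall i \near U, (a < f i)%E.
  move=> /ereal_sup_gt[x /= xf ax].
  by apply: filterS xf => i; exact: lt_le_trans.
have gts (b : \bar R) : (s < b)%E -> \forall i \near U, (f i < b)%E.
  move=> sb; have : \forall i \near U, ~ (b <= f i)%E.
    apply/ultra_near_not => bf.
    by move: sb; rewrite ltNge => /negP; apply; exact: ereal_sup_ubound.
  by apply: filterS => i /negP; rewrite -ltNge.
(* A neighbourhood contains an open interval, possibly unbounded, around the supremum; its two ends
   are handled separately. *)
move=> X; rewrite itv_nbhsE => -[[l r] [lr_open]].
rewrite itv_boundlr => /andP[ls sr] lrX.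
have fl : \forall i \near U, (l <= BLeft (f i))%O.
  case: l ls lr_open {lrX} => [b a|b] ls lr_open.
    by move: ls; rewrite (itv_open_ends_lside lr_open); exact: lts.
  by rewrite (itv_open_ends_linfty lr_open); exact: filterE.
have fr : \forall i \near U, (BRight (f i) <= r)%O.
  case: r sr lr_open {lrX} => [b a|b] sr lr_open.
    by move: sr; rewrite (itv_open_ends_rside lr_open); exact: gts.
  by rewrite (itv_open_ends_rinfty lr_open); exact: filterE.
apply: filterS2 fl fr => i fl fr; apply: lrX.
by rewrite /= itv_boundlr fl fr.
Qed.

(** [umu_family] is a [lim], which is a genuine limit once some limit exists; the supremum above
    provides one. *)
Lemma umu_family_cvg (L : signature) (R : realType) (I : Type)
    (U : set_system I) (UU : UltraFilter U) (M : I -> aml_data L R) (n : nat)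
    (A : forall i, set ('I_n -> M i)) :
  mu (M i) (A i) @[i --> U] --> umu_family U A.
Proof.
apply/cvg_ex; eexists; exact: ultra_cvg_ereal.
Qed.

(** * Assignments and dependence on free variables *)

Lemma assign_tnth (T : Type) (e : nat -> T) (n : nat) (x : n.-tuple nat)
    (a : 'I_n -> T) (k : 'I_n) : uniq x -> assign e x a (tnth x k) = a k.
Proof.
move=> x_uniq; rewrite /assign; case: pickP => [j /eqP|/(_ k)]; last first.
  by rewrite eqxx.
by move/(tuple_uniqP _ x_uniq) => ->.
Qed.

Lemma eval_free_vars (L : signature) (M : fo_structure L) (t : term L)
    (e e' : nat -> M) :
  (forall y, term_vars t y -> e y = e' y) -> Defs.eval e t = Defs.eval e' t.
Proof.
elim: t => [y|f ts IH] /= ee'; first exact: ee'.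
by congr fun_interp; apply/funext => k; apply: IH => y ty; apply: ee'; exists k.
Qed.

Lemma sat_free_vars (L : signature) (R : realType) (M : aml_data L R)
    (phi : formula L) (e e' : nat -> M) :
  (forall y, free_vars phi y -> e y = e' y) -> sat e phi <-> sat e' phi.
Proof.
have assign1_eq (psi : formula L) x (f f' : nat -> M) b :
    (forall y, (free_vars psi `\ x) y -> f y = f' y) ->
    forall y, free_vars psi y -> assign1 f x b y = assign1 f' x b y.
  move=> ff' y psi_y; rewrite /assign1; case: eqP => // yx.
  by apply: ff'; split.
elim: phi e e' => [t u|r ts|psi IH|psi IHpsi chi IHchi|x psi IH|x psi IH|
    c n x q n_gt0 x_uniq q_ge0 psi IH] e e' /= ee'.
- by rewrite !(@eval_free_vars _ _ _ e e')// => y ?; apply: ee'; [right|left].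
- suff -> : (fun k => Defs.eval e (ts k)) = (fun k => Defs.eval e' (ts k)) by [].
  by apply/funext => k; apply: eval_free_vars => y ?; apply: ee'; exists k.
- by have [H1 H2] := IH _ _ ee'; split; auto.
- have [H1 H2] : sat e psi <-> sat e' psi by apply: IHpsi => y ?; apply: ee'; left.
  have [H3 H4] : sat e chi <-> sat e' chi by apply: IHchi => y ?; apply: ee'; right.
  by split=> -[]; auto.
- have IHb b := IH _ _ (assign1_eq _ _ _ _ b ee').
  by split=> -[b eb]; exists b; apply/(IHb b).
- have IHb b := IH _ _ (assign1_eq _ _ _ _ b ee').
  by split=> eb b; apply/(IHb b).
- suff -> : [set a | sat (assign e x a) psi] = [set a | sat (assign e' x a) psi]
    by [].
  apply/funext => a; apply/propext; apply: IH => y psi_y.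
  (* On the tuple both assignments take the values of [a]; a variable of [psi] off the tuple is
     still free in the whole formula. *)
  rewrite /assign; case: pickP => // xy; apply: ee'; split=> // /= /tnthP[k yk].
  by have := xy k; rewrite -yk eqxx.
Qed.

(** Reduces [models], which quantifies over all assignments extending [a], to [sat] at any one of
    them. *)
Lemma models_sat (L : signature) (R : realType) (M : aml_data L R)
    (phi : formula L) (n : nat) (x : n.-tuple nat) (a : 'I_n -> M)
    (e : nat -> M) :
  free_vars phi `<=` [set` x] -> (forall k, e (tnth x k) = a k) ->
  models M phi x a <-> sat e phi.
Proof.
move=> phi_x ea; split=> [|sat_e e' e'a]; first exact.
have [+ _] : sat e phi <-> sat e' phi; last exact.
by apply: sat_free_vars => y /phi_x /= /tnthP[k ->]; rewrite e'a ea.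
Qed.

(** * Transfer between the factors and the ultraproduct *)

Section Los.
Variables (L : signature) (R : realType) (I : Type) (U : set_system I).
Context {UU : UltraFilter U}.
Variable M : I -> aml_data L R.
Hypothesis M_aml : forall i, is_aml_structure (M i).
Implicit Types e : forall i, nat -> M i.

Lemma meas_holds_uset c (q : rat) n (A : forall i, set ('I_n -> M i)) :
  (forall i, alg (M i) n (A i)) ->
  meas_holds (M := ultraproduct U M) c q (uset U A) <->
  \forall i \near U, meas_holds c q (A i).
Proof.
move=> A_alg; rewrite /meas_holds umuE// uvE//.
have mu_cvg := @umu_family_cvg _ _ _ _ UU _ _ A.
have nF (P : I -> Prop) : (\forall i \near U, P i) ->
    (\forall i \near U, ~ P i) -> False by move=> ? /ultra_near_not.
have [ltq|gtq|eqq] := ltgtP (umu_family U A) (ratr q)%:E.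
(* The open ray below q contains the limit, hence almost all measures; both sides of the equivalence
   hold. In the next case both fail. *)
- have near_ltq : \forall i \near U, (mu (M i) (A i) < (ratr q)%:E)%E.
    by apply: (mu_cvg [set y | (y < (ratr q)%:E)%E]); exact: open_ereal_lt'.
  by split=> _; [apply: filterS near_ltq => i ?|]; left.
- have near_gtq : \forall i \near U, ((ratr q)%:E < mu (M i) (A i))%E.
    by apply: (mu_cvg [set y | ((ratr q)%:E < y)%E]); exact: open_ereal_gt'.
  split=> [[//|[qE]]|holds]; first by move: gtq; rewrite qE ltxx.
  exfalso; apply: (nF _ near_gtq); apply: filterS holds => i [|[-> _]].
    by move=> lti gti; have := lt_trans lti gti; rewrite ltxx.
  by rewrite ltxx.
(* Trichotomy holds at each index, and an ultrafilter containing a finite union contains one of its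
   members. *)
have v_cases : [\/ (\forall i \near U, ((ratr q)%:E < mu (M i) (A i))%E),
    (\forall i \near U, (mu (M i) (A i) < (ratr q)%:E)%E) |
    (\forall i \near U, mu (M i) (A i) = (ratr q)%:E)].
  suff : \forall i \near U, ((ratr q)%:E < mu (M i) (A i))%E \/
      ((mu (M i) (A i) < (ratr q)%:E)%E \/ mu (M i) (A i) = (ratr q)%:E).
    move=> /ultra_near_or[|/ultra_near_or[]]; by constructor.
  apply: filterE => i.
  by case: (ltgtP (mu (M i) (A i)) (ratr q)%:E); auto.
rewrite /uv_family eqq asboolF; last by apply; exists q.
have [gtq|ltq|eq_mu] := v_cases.
- rewrite asboolT//; split.
    by case=> [//|[_]]; case: c.
  move=> holds; exfalso; apply: (nF _ gtq); apply: filterS holds => i.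
  case=> [lti gti|[-> _]]; last by rewrite ltxx.
  by have := lt_trans lti gti; rewrite ltxx.
- rewrite asboolF; last first.
    move=> gtq; apply: (nF _ gtq); apply: filterS ltq => i lti gti.
    by have := lt_trans lti gti; rewrite ltxx.
  rewrite asboolT//; split=> _; last by right; split=> //; case: c.
  by apply: filterS ltq => i; left.
- rewrite asboolF; last first.
    by move=> gtq; apply: (nF _ gtq); apply: filterS eq_mu => i ->; rewrite ltxx.
  rewrite asboolF; last first.
    by move=> ltq; apply: (nF _ ltq); apply: filterS eq_mu => i ->; rewrite ltxx.
  have vE : (exists s, (\forall i \near U, v (M i) (A i) = s)).
    suff : \forall i \near U, v (M i) (A i) = Oplus \/
        (v (M i) (A i) = Ominus \/ v (M i) (A i) = Odot).
      by move=> /ultra_near_or[|/ultra_near_or[]] vA; eexists; exact: vA.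
    by apply: filterE => i; case: (v (M i) (A i)); auto.
  case: vE => s vs.
  (* The remaining tests of [uv_family] return [s], since any test for another value fails. *)
  have -> : (if `[< \forall i \near U, v (M i) (A i) = Oplus >] then Oplus
      else if `[< \forall i \near U, v (M i) (A i) = Ominus >] then Ominus
      else Odot) = s.
    have v_neq s' : s <> s' -> `[< \forall i \near U, v (M i) (A i) = s' >] = false.
      move=> ss'; apply: asboolF => vs'; apply: (nF _ vs).
      by apply: filterS vs' => i ->; exact: nesym.
    case: s vs v_neq => vs v_neq; first by rewrite asboolT.
      by rewrite v_neq// asboolT.
    by rewrite !v_neq.
  split=> [[//|[_ cs]]|holds].
    apply: filterS2 eq_mu vs => i -> vAi; right; split=> //.
    by rewrite vAi.
  (* Members of an ultrafilter are nonempty, so a single index carries all three facts. *)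
  have [i [[muAi vAi] holds_i]] := filter_ex (filterI (filterI eq_mu vs) holds).
  right; split=> //.
  by move: holds_i; rewrite muAi ltxx vAi => -[//|[]].
Qed.

Definition uassign e : nat -> ultraproduct U M :=
  fun y => uclass U (fun i => e i y).

Lemma uclass_urepr (x : ultraproduct U M) : uclass U (urepr x) = x.
Proof. by rewrite /uclass /urepr reprK. Qed.

Lemma urepr_uclass (a : forall i, M i) :
  \forall i \near U, urepr (uclass U a) i = a i.
Proof. by apply/uclass_eq; exact: uclass_urepr. Qed.

Lemma uassign_surj (E : nat -> ultraproduct U M) : exists e, E = uassign e.
Proof.
exists (fun i y => urepr (E y) i); apply/funext => y.
by rewrite /uassign uclass_urepr.
Qed.

Lemma assign1_uassign e x (b : forall i, M i) :
  assign1 (uassign e) x (uclass U b) = uassign (fun i => assign1 (e i) x (b i)).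
Proof.
by apply/funext => y; rewrite /uassign /assign1; case: (y == x).
Qed.

Lemma assign_uassign e n (x : n.-tuple nat) (a : forall i, 'I_n -> M i) :
  assign (uassign e) x (utuple (U := U) a) =
  uassign (fun i => assign (e i) x (a i)).
Proof.
by apply/funext => y; rewrite /uassign /assign; case: pickP.
Qed.

Lemma eval_uassign e (t : term L) :
  Defs.eval (uassign e) t = uclass U (fun i => Defs.eval (e i) t).
Proof.
elim: t => [//|f ts IH] /=; apply/uclass_eq.
(* Functions are interpreted through chosen representatives, correct only almost everywhere for each
   argument; finite arity gives one common set in [U]. *)
have : \forall i \near U, forall k,
    urepr (Defs.eval (uassign e) (ts k)) i = Defs.eval (e i) (ts k).
  apply: (@filter_forall _ _ (fun k i =>
    urepr (Defs.eval (uassign e) (ts k)) i = Defs.eval (e i) (ts k))) => k.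
  by rewrite IH; exact: urepr_uclass.
by apply: filterS => i ts_i; congr fun_interp; apply/funext.
Qed.

(** Transfer for [phi] is a hypothesis, so that this serves both inside the induction below and
    after it. It ranges over all assignments because each point of the set changes the
    assignment. *)
Lemma definable_uassign (phi : formula L) n (x : n.-tuple nat) e :
  (forall e', sat (uassign e') phi <-> \forall i \near U, sat (e' i) phi) ->
  definable phi x (uassign e) = uset U (fun i => definable phi x (e i)).
Proof.
move=> phiP; apply/funext => a; apply/propext.
have -> : a = utuple (fun i k => urepr (a k) i).
  by apply/funext => k; rewrite /utuple uclass_urepr.
by rewrite uset_utuple /definable /= assign_uassign; exact: phiP.
Qed.

Lemma sat_uassign (phi : formula L) e :
  sat (uassign e) phi <-> \forall i \near U, sat (e i) phi.
Proof.
elim: phi e => [t u|r ts|psi IH|psi IHpsi chi IHchi|x psi IH|x psi IH|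
    c n x q n_gt0 x_uniq q_ge0 psi IH] e /=.
- by rewrite !eval_uassign; exact: uclass_eq.
- have -> : (fun k => Defs.eval (uassign e) (ts k)) =
      utuple (U := U) (fun i k => Defs.eval (e i) (ts k)).
    by apply/funext => k; exact: eval_uassign.
  exact: uset_utuple.
- by rewrite IH; exact: ultra_near_not.
- rewrite IHpsi IHchi; split=> [[]|psi_chi]; first exact: filterS2.
  by split; apply: filterS psi_chi => i [].
- split=> [[b]|ex].
    rewrite -(uclass_urepr b) assign1_uassign => /IH.
    by apply: filterS => i; exists (urepr b i).
  (* A witness where the factor has one, an arbitrary element elsewhere. *)
  have b_ i : exists b, (exists b, sat (assign1 (e i) x b) psi) ->
      sat (assign1 (e i) x b) psi.
    have [[b psi_b]|nb] := pselect (exists b, sat (assign1 (e i) x b) psi).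
      by exists b.
    by have [b] := carrier_inhabited (M i); exists b.
  exists (uclass U (fun i => sval (cid (b_ i)))); rewrite assign1_uassign.
  by apply/IH; apply: filterS ex => i; exact: svalP (cid (b_ i)).
- split=> [all|all b]; last first.
    rewrite -(uclass_urepr b) assign1_uassign; apply/IH.
    by apply: filterS all => i; exact.
  (* A counterexample where the factor has one, so truth at the chosen element implies the universal
     statement. *)
  have b_ i : exists b, sat (assign1 (e i) x b) psi ->
      forall b, sat (assign1 (e i) x b) psi.
    have [psi_all|/existsNP[b nb]] := pselect (forall b, sat (assign1 (e i) x b) psi).
      by have [b] := carrier_inhabited (M i); exists b.
    by exists b.
  have := all (uclass U (fun i => sval (cid (b_ i)))).
  by rewrite assign1_uassign => /IH; apply: filterS => i; exact: svalP (cid (b_ i)).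
- rewrite -[X in meas_holds _ _ X]/(definable psi x (uassign e)).
  rewrite (definable_uassign _ _ IH) meas_holds_uset// => i.
  exact: aml_definable (M_aml i) _ _ _ _ n_gt0 x_uniq.
Qed.

(** Every assignment lifts to the factors, so a definable set is the ultraproduct of sets definable
    in the factors, which lie in their algebras. *)
Lemma ultraproduct_definable_in_alg : definable_in_alg (ultraproduct U M).
Proof.
move=> phi n x E n_gt0 x_uniq; have [e ->] := uassign_surj E.
rewrite definable_uassign; last exact: sat_uassign.
exists (fun i => definable phi x (e i)) => // i.
exact: aml_definable (M_aml i) _ _ _ _ n_gt0 x_uniq.
Qed.

End Los.

(* The first conjunct says that satisfaction in the ultraproduct is defined. *)
Theorem mainTheorem1 (L : signature) (R : realType) (I : Type)
    (U : set_system I) (UU : UltraFilter U) (M : I -> aml_data L R)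
    (M_aml : forall i, is_aml_structure (M i))
    (phi : formula L) (n : nat) (x : n.-tuple nat) (x_uniq : uniq x)
    (phi_x : free_vars phi `<=` [set` x])
    (a : 'I_n -> forall i, M i) :
  definable_in_alg (ultraproduct U M) /\
  (models (ultraproduct U M) phi x (fun k => uclass U (a k)) <->
   U [set i | models (M i) phi x (fun k => a k i)]).
Proof.
split; first exact: ultraproduct_definable_in_alg.
have e0 i : exists b : M i, True.
  by have [b] := carrier_inhabited (M i); exists b.
(* [sat] needs a value at every variable, so off [x] an arbitrary element is used. *)
pose e i := assign (fun=> sval (cid (e0 i))) x (fun k => a k i).
have eE i k : e i (tnth x k) = a k i by exact: assign_tnth.
rewrite (@models_sat _ _ _ _ _ _ _ (uassign e))//; last first.
  by move=> k; apply/uclass_eq; apply: filterE => i; exact: eE.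
rewrite sat_uassign//; split; apply: filterS => i /=.
  by move=> ?; apply/(models_sat phi_x (eE i)).
by move=> /(models_sat phi_x (eE i)).
Qed.
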